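(* Let $\Lambda^U(z)$ be the monic block characteristic polynomial of $A_j^{U,Z}$ with respect to $E_1R_B$. If $A_j^{U,Z}$ has simple eigenvalues $\theta_1,\dots,\theta_{js}$ and $A$ is diagonalizable with eigenvalues $\lambda_1,\dots,\lambda_n$, then $$\|f(A)B-F_j\|_F\le\kappa_{\mathrm{eig}}(A)\,\left\|\Pi_{U,Z}U_{j+1}\Gamma_{j+1}^UR_B\right\|_F\,\max_{h=1,\dots,n}\|L(\lambda_h)\|_2,$$ where $\kappa_{\mathrm{eig}}(A)$ indicates the 2-norm condition number of an eigenvector matrix of $A$, and $$L(\lambda_h)=\sum_{i=1}^{js}\frac{\varphi(\lambda_h)f(\lambda_h)-\varphi(\theta_i)f(\theta_i)}{\lambda_h-\theta_i}\,v_iw_i^*,$$ with $v_i,w_i\in\mathbb C^s$ right and left eigenvectors of $\Lambda^U(z)$ associated with $\theta_i$, normalized such that $w_i^*(\Lambda^U)'(\theta_i)v_i=1$.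
   Context: Let $A\in\mathbb C^{n\times n}$, $B\in\mathbb C^{n\times s}$ with $s>1$, $j\ge 1$, and shifts $\Sigma=\{\sigma_1,\dots,\sigma_{j-1}\}\subset\mathbb C\cup\{\infty\}$, the finite ones not eigenvalues of $A$. Put $\varphi(z)=\prod_{\sigma_i\neq\infty}(z-\sigma_i)$ and $E_1=e_1\otimes I_s\in\mathbb C^{js\times s}$, with $e_1$ the first canonical basis vector. For an $s\times s$ matrix polynomial $P(\lambda)=\sum_i\lambda^iP_i$, a square matrix $N$ and a block vector $W$ with $s$ columns, $P(N)\circ W:=\sum_iN^iWP_i$. Block rational Krylov spaces: $\mathcal{RK}^\square_j(A,B,\Sigma)=\{\varphi(A)^{-1}(P(A)\circ B):\deg P<j\}$ and $\mathcal{RK}^\square_{j+1}(A,B,\Sigma)=\{\varphi(A)^{-1}(P(A)\circ B):\deg P\le j\}$, where $P$ ranges over $s\times s$ matrix polynomials (in the second space the last pole is at infinity). Standing assumptions. The block rational Arnoldi procedure for building a block orthogonal basis of $\mathcal{RK}^\square_{j+1}(A,B,\Sigma)$ has been run without breakdown or deflation (every generated block has full rank $s$), with the last pole at infinity. It gives a matrix with orthonormal columns $\mathbf U_{j+1}=[U_1,\dots,U_{j+1}]$, $U_i\in\mathbb C^{n\times s}$, such that $\mathcal{RK}^\square_m(A,B,\Sigma)=\{\sum_{i\le m}U_iC_i: C_i\in\mathbb C^{s\times s}\}$ for $m=j,j+1$, with $B=U_1R_B$, $R_B\in\mathbb C^{s\times s}$, and block upper Hessenberg $(j+1)s\times js$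 matrices $\underline H_{U,j},\underline K_{U,j}$ (with $s\times s$ blocks) such that $A\mathbf U_{j+1}\underline K_{U,j}=\mathbf U_{j+1}\underline H_{U,j}$, the last block row of $\underline K_{U,j}$ being zero. $\Gamma_{j+1}^U$ is the block of $\underline H_{U,j}$ in block position $(j+1,j)$. Let $\mathbf U_j=[U_1,\dots,U_j]$, and let $\mathbf Z_j\in\mathbb C^{n\times js}$ have orthonormal columns with $\mathbf Z_j^*\mathbf U_j$ invertible. Put $A_j^{U,Z}=(\mathbf Z_j^*\mathbf U_j)^{-1}\mathbf Z_j^*A\mathbf U_j$ and $\Pi_{U,Z}=I-\mathbf U_j(\mathbf Z_j^*\mathbf U_j)^{-1}\mathbf Z_j^*$. The shifts $\sigma_i$ are not eigenvalues of $A_j^{U,Z}$. A block characteristic polynomial of $N\in\mathbb C^{js\times js}$ with respect to $W\in\mathbb C^{js\times s}$ is an $s\times s$ matrix polynomial $P$ of degree $j$ with $P(N)\circ W=0$; it is monic if its leading coefficient is $I_s$. In the present setting the monic block characteristic polynomial $\Lambda^U$ of $A_j^{U,Z}$ with respect to $E_1R_B$ is unique, and its eigenvalues (roots of $\det\Lambda^U$) are those of $A_j^{U,Z}$; right and left eigenvectors for $\theta_i$ satisfy $\Lambda^U(\theta_i)v_i=0$ and $w_i^*\Lambda^U(\theta_i)=0$. The function $f$ is analytic around the eigenvalues of $A$, and the Petrov-Galerkin approximation of $f(A)B$ is $F_j=\mathbf U_jf(A_j^{U,Z})E_1R_B$, with $f(A_j^{U,Z})$ assumed to be defined.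
   Formalization: Added hypothesis: the last block column of K_{U,j} is scaled so that U_j K e_j R_B = φ(A)^{-1}(P(A)∘B) with P monic of degree j-1; without this normalization of Γ_{j+1}^U the bound fails, e.g. for standard polynomial Arnoldi with j = 2. *)

(* Defs.v *)
From HB Require Import structures.
From mathcomp Require Import all_boot all_order all_algebra.
From mathcomp Require Import complex.
From mathcomp Require Import all_classical all_reals all_analysis.

Set Implicit Arguments.
Unset Strict Implicit.
Unset Printing Implicit Defensive.

Import Order.TTheory GRing.Theory Num.Theory.
Import numFieldNormedType.Exports.
Import ComplexField.

Local Open Scope classical_set_scope.
Local Open Scope ring_scope.
Local Open Scope complex_scope.
Local Open Scope sesquilinear_scope.

Section Norms.
Context {R : realType}.
Local Notation C := R[i].

Definition normF m n (M : 'M[C]_(m, n)) : R :=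
  Num.sqrt (\sum_i \sum_j Normc.normc (M i j) ^+ 2).

(* On column vectors [normF] is the Euclidean norm. *)
Definition norm2 m n (M : 'M[C]_(m, n)) : R :=
  sup [set normF (M *m x) | x in [set x : 'cV[C]_n | normF x = 1]].

Definition cond2 n (X : 'M[C]_n) : R := norm2 X * norm2 (invmx X).

End Norms.

Section MatrixFunctions.
Context {R : realType}.
Local Notation C := R[i].

(* Same as [horner_mx], but for matrices of arbitrary order. *)
Definition poly_mx n (N : 'M[C]_n) (p : {poly C}) : 'M[C]_n :=
  \sum_(i < size p) p`_i *: N ^+ i.

(* [C^o] carries the topology of C, and differentiability in the direction 1
   with scalars in C is complex differentiability. *)
Definition analytic_at (f : C -> C) (z : C) : Prop :=
  \forall w \near (z : C^o), derivable (f : C^o -> C^o) w 1.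

Definition cderiv (k : nat) (f : C -> C) : C -> C :=
  derive1n k (f : C^o -> C^o).

(* k is smaller than the index of lam, i.e. than the size of the largest Jordan
   block of N for lam; never holds if lam is not an eigenvalue of N. *)
Definition lt_index n (N : 'M[C]_n) (lam : C) (k : nat) : bool :=
  (\rank ((N - lam%:M) ^+ k.+1) < \rank ((N - lam%:M) ^+ k))%N.

Definition interpolates_on_spectrum n (f : C -> C) (N : 'M[C]_n)
    (p : {poly C}) : Prop :=
  forall lam k, lt_index N lam k -> p^`(k).[lam] = cderiv k f lam.

(* f(N) is the common value p(N) of all the polynomials p that Hermite
   interpolate f on the spectrum of N. *)
Definition fun_mx (f : C -> C) n (N : 'M[C]_n) : 'M[C]_n :=
  xget 0 [set X | exists2 p, interpolates_on_spectrum f N p & X = poly_mx N p].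

(* The derivatives of f used in f(N) exist (f itself is a total function). *)
Definition fun_mx_defined (f : C -> C) n (N : 'M[C]_n) : Prop :=
  forall lam k, lt_index N lam k.+1 ->
    derivable (cderiv k f : C^o -> C^o) lam 1.

(* Divided difference g[x, y], with its limit value g'(x) on the diagonal. *)
Definition divdiff (g : C -> C) (x y : C) : C :=
  if x == y then cderiv 1 g x else (g x - g y) / (x - y).

End MatrixFunctions.

(* An s x s matrix polynomial is represented by the matrix of its entries,
   P : 'M[{poly C}]_s. *)
Section MatrixPolynomials.
Context {R : realType}.
Local Notation C := R[i].
Variable s : nat.
Implicit Types P : 'M[{poly C}]_s.

(* One more than the degree of P, and 0 for P = 0 (as [size] for [{poly C}]). *)
Definition mp_size P : nat := \max_(a < s) \max_(b < s) size (P a b).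

Definition mp_coef P (i : nat) : 'M[C]_s := map_mx (coefp i) P.

Definition mp_lead P : 'M[C]_s := mp_coef P (mp_size P).-1.

Definition mp_monic P : Prop := mp_lead P = 1%:M.

Definition mp_eval P (t : C) : 'M[C]_s := map_mx (horner_eval t) P.

Definition mp_deriv P : 'M[{poly C}]_s := map_mx (@deriv C) P.

(* P(N) o W = \sum_i N^i W P_i *)
Definition mp_act m P (N : 'M[C]_m) (W : 'M[C]_(m, s)) : 'M[C]_(m, s) :=
  \sum_(i < mp_size P) N ^+ i *m W *m mp_coef P i.

(* d is the degree, i.e. the number of blocks of W. *)
Definition block_charpoly (d m : nat) (N : 'M[C]_m) (W : 'M[C]_(m, s)) P
    : Prop :=
  mp_size P = d.+1 /\ mp_act P N W = 0.

Definition right_eigenvector P (t : C) (v : 'cV[C]_s) : Prop :=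
  v != 0 /\ mp_eval P t *m v = 0.

Definition left_eigenvector P (t : C) (w : 'cV[C]_s) : Prop :=
  w != 0 /\ w^t* *m mp_eval P t = 0.

End MatrixPolynomials.

Section BlockRationalKrylov.
Context {R : realType}.
Local Notation C := R[i].
Variables (n s : nat) (A : 'M[C]_n) (B : 'M[C]_(n, s)).

(* A shift is an element of [option C], [None] being the point at infinity. *)
Definition shift_poly (sigma : seq (option C)) : {poly C} :=
  \prod_(a <- pmap id sigma) ('X - a%:P).

Definition shifts_not_eigenvalues m (N : 'M[C]_m) (sigma : seq (option C))
    : Prop :=
  forall a, Some a \in sigma -> ~~ eigenvalue N a.

(* phi(A)^-1 (P(A) o B) *)
Definition rk_elt (sigma : seq (option C)) (P : 'M[{poly C}]_s)
    : 'M[C]_(n, s) :=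
  invmx (poly_mx A (shift_poly sigma)) *m mp_act P A B.

(* The space RK_m. The poles beyond those listed in sigma are at infinity, so
   that the denominator is the same for m = j and m = j + 1. *)
Definition block_rk (sigma : seq (option C)) (m : nat) : set 'M[C]_(n, s) :=
  [set X | exists2 P, (mp_size P <= m)%N & X = rk_elt sigma P].

(* Blocks are indexed from 0: U i stands for U_(i+1), and H i k, K i k are
   the blocks in position (i+1, k+1). Only U 0, ..., U j, and H i k, K i k with
   i <= j and k < j, are relevant. A matrix with m blocks of s columns has
   \sum_(i < m) s columns. *)
Definition blocks (U : nat -> 'M[C]_(n, s)) (m : nat)
    : 'M[C]_(n, \sum_(i < m) s) :=
  \mxrow_(i < m) U i.

Definition block_span (U : nat -> 'M[C]_(n, s)) (m : nat)
    : set 'M[C]_(n, s) :=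
  [set X | exists D : nat -> 'M[C]_s, X = \sum_(i < m) U i *m D i].

Definition block_unit1 (m : nat) : 'M[C]_(\sum_(i < m) s, s) :=
  \mxcol_(i < m) ((i == 0%N :> nat)%:R%:M : 'M[C]_s).

(* What the block rational Arnoldi procedure produces after j steps, run without
   breakdown or deflation and with last pole at infinity. *)
Record block_rational_arnoldi (j : nat) (sigma : seq (option C))
    (U : nat -> 'M[C]_(n, s)) (RB : 'M[C]_s) (H K : nat -> nat -> 'M[C]_s)
    : Prop := BlockRationalArnoldi {
  arnoldi_orthonormal : (blocks U j.+1)^t* *m blocks U j.+1 = 1%:M;
  arnoldi_span : block_rk sigma j = block_span U j;
  arnoldi_spanS : block_rk sigma j.+1 = block_span U j.+1;
  arnoldi_start : B = U 0%N *m RB;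
  arnoldi_start_full : RB \in unitmx;
  arnoldi_last_full : H j j.-1 \in unitmx;
  arnoldi_hessenbergH : forall i k, (i <= j)%N -> (k < j)%N ->
    (k.+1 < i)%N -> H i k = 0;
  arnoldi_hessenbergK : forall i k, (i <= j)%N -> (k < j)%N ->
    (k.+1 < i)%N -> K i k = 0;
  arnoldi_relation :
    A *m blocks U j.+1 *m (\mxblock_(i < j.+1, k < j) K i k)
    = blocks U j.+1 *m (\mxblock_(i < j.+1, k < j) H i k);
  arnoldi_last_rowK : forall k, (k < j)%N -> K j k = 0
}.

(* The pencil (H, K) is determined by A U K = U H only up to block upper
   triangular transformations of the columns, which rescale the last
   subdiagonal block of H. This fixes the scaling of the last block column: the
   continuation block U_j (K e_j) fed to the last step is, on B, of the form
   phi(A)^-1 (P(A) o B) with P monic of degree j - 1. *)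
Definition monic_continuation (j : nat) (sigma : seq (option C))
    (U : nat -> 'M[C]_(n, s)) (RB : 'M[C]_s) (K : nat -> nat -> 'M[C]_s)
    : Prop :=
  exists P : 'M[{poly C}]_s, [/\ mp_size P = j, mp_monic P &
    (\sum_(i < j) U i *m K i j.-1) *m RB = rk_elt sigma P].

End BlockRationalKrylov.

Section PetrovGalerkin.
Context {R : realType}.
Local Notation C := R[i].
Variables (n m : nat).
Implicit Types U Z : 'M[C]_(n, m).

Definition pg_matrix (A : 'M[C]_n) U Z : 'M[C]_m :=
  invmx (Z^t* *m U) *m Z^t* *m A *m U.

Definition pg_coprojector U Z : 'M[C]_n :=
  1%:M - U *m invmx (Z^t* *m U) *m Z^t*.

End PetrovGalerkin.

(* Main.v *)
Require Import Defs.
From HB Require Import structures.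
From mathcomp Require Import all_boot all_order all_algebra.
From mathcomp Require Import complex.
From mathcomp Require Import all_classical all_reals all_analysis.
From mathcomp Require Import ring.

Set Implicit Arguments.
Unset Strict Implicit.
Unset Printing Implicit Defensive.

Import Order.TTheory GRing.Theory Num.Theory.
Import numFieldNormedType.Exports.
Local Open Scope ring_scope.
Local Open Scope complex_scope.
Local Open Scope sesquilinear_scope.

(** Write V for the basis of the first j blocks, G = (Z^H V)^-1 Z^H, so that
    G V = 1, N = G A V for the projected matrix, phi for the denominator,
    Y = phi(A)^-1 B and c = G Y.

    Exactness on the Krylov space.  The span of V contains A^k Y for k < j.
    Hence G A^k Y = N^k c for k <= j, and V N^k c = A^k Y for k < j
    ([rk_coordinates]): lifting by V takes P(N) o c to P(A) o Y for
    deg P < j.  In particular phi(N) c = G B is the starting block E_1 R_B, so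
    Lambda(N) o c = 0 as well, phi(N) being invertible.  As the N^k c, k < j,
    span the whole space, they form a square invertible matrix.

    Spectral decomposition.  Put Lambda(z) = Lambda(t) + (z - t) Q_t(z) and
    x_i = (Q_{theta_i}(N) o c) v_i.  From Lambda(N) o c = 0 it follows that
    N x_i = theta_i x_i.  The rows z_i with z_i N^k c = theta_i^k w_i^H, k < j,
    are dual to the x_i: this is where the normalization of v_i and w_i
    enters.  By counting, the x_i form a basis, so c = sum_i x_i w_i^H
    ([block_charpoly_eigenbasis]); this plays the part of the partial fraction
    expansion of Lambda^-1.

    Error.  Let r be a left eigenvector of A for lam, y = r Y, and g = phi f.
    Since r V x_i = y Q_{theta_i}(lam) v_i, the decomposition of c gives
      r (f(A) B - F_j)
        = sum_i (g(lam) - g(theta_i)) y Q_{theta_i}(lam) v_i w_i^H,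
    and (lam - theta_i) Q_{theta_i}(lam) v_i = Lambda(lam) v_i turns this into
    r (Lambda(A) o Y) L(lam) ([galerkin_error_row]).  If lam = theta_i, the
    i-th terms of both sums vanish, since Lambda(theta_i) v_i = 0.

    Residual.  G kills Lambda(A) o Y, and the Arnoldi relation shows
    Lambda(A) o Y = U_j Gamma R_B modulo the span of V ([arnoldi_residual]);
    hence Lambda(A) o Y is the oblique coprojection of U_j Gamma R_B.

    In the eigenvector basis X of A, row h of X^-1 (f(A) B - F_j) is therefore
    row h of X^-1 (Lambda(A) o Y) times L(lambda_h), and the bound follows from
    |M W|_F <= |M|_2 |W|_F, used for X and X^-1, and |r M| <= |r| |M|_2, used
    for each L(lambda_h). *)

(** * Polynomials of a square matrix *)

Lemma poly_mx_widen (R : realType) n (N : 'M[R[i]]_n) (p : {poly R[i]}) d :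
  (size p <= d)%N -> poly_mx N p = \sum_(i < d) p`_i *: N ^+ i.
Proof.
move=> le_pd; rewrite /poly_mx
  (big_ord_widen _ (fun i => p`_i *: N ^+ i) le_pd).
rewrite big_mkcond; apply: eq_bigr => i _.
by case: ltnP => // le_pi; rewrite nth_default // scale0r.
Qed.

(** This gives access to the ring morphism [horner_mx], which exists only for
    nonzero order; order 0 is a trivial case apart. *)
Lemma poly_mx_horner (R : realType) n (N : 'M[R[i]]_n.+1) (p : {poly R[i]}) :
  poly_mx N p = horner_mx N p.
Proof.
rewrite -[in RHS](coefK p) poly_def rmorph_sum; apply: eq_bigr => i _.
by rewrite /= (horner_mxZ N) rmorphXn /= horner_mx_X.
Qed.

Lemma poly_mxM (R : realType) n (N : 'M[R[i]]_n) (p q : {poly R[i]}) :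
  poly_mx N (p * q) = poly_mx N p *m poly_mx N q.
Proof.
case: n N => [N|n N]; first by apply/matrixP => -[].
by rewrite !poly_mx_horner rmorphM.
Qed.

Lemma poly_mx1 (R : realType) n (N : 'M[R[i]]_n) : poly_mx N 1 = 1%:M.
Proof.
by rewrite (@poly_mx_widen _ _ _ _ 1) ?size_poly1 // big_ord1 coef1 scale1r
  expr0.
Qed.

Lemma poly_mx_XsubC (R : realType) n (N : 'M[R[i]]_n) (a : R[i]) :
  poly_mx N ('X - a%:P) = N - a%:M.
Proof.
case: n N => [N|n N]; first by apply/matrixP => -[].
by rewrite poly_mx_horner rmorphB /= horner_mx_X horner_mx_C.
Qed.

Lemma poly_mx_commX (R : realType) n (N : 'M[R[i]]_n) (p : {poly R[i]}) k :
  N ^+ k *m poly_mx N p = poly_mx N p *m N ^+ k.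
Proof.
rewrite /poly_mx mulmx_sumr mulmx_suml; apply: eq_bigr => i _.
by rewrite -scalemxAr -scalemxAl; congr (_ *: _);
  rewrite -![_ *m _]/(_ * _) -!exprD addnC.
Qed.

Lemma expmx_rowE (R : realType) n (N : 'M[R[i]]_n) (r : 'rV[R[i]]_n) (t : R[i])
    k :
  r *m N = t *: r -> r *m N ^+ k = t ^+ k *: r.
Proof.
move=> rN; elim: k => [|k IHk]; first by rewrite !expr0 scale1r mulmx1.
by rewrite exprS mulmxA rN -scalemxAl IHk scalerA -exprS.
Qed.

Lemma expmx_colE (R : realType) n (N : 'M[R[i]]_n) (x : 'cV[R[i]]_n) (t : R[i])
    k :
  N *m x = t *: x -> N ^+ k *m x = t ^+ k *: x.
Proof.
move=> Nx; elim: k => [|k IHk]; first by rewrite !expr0 scale1r mul1mx.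
by rewrite exprSr -mulmxA Nx -scalemxAr IHk scalerA -exprS.
Qed.

Lemma poly_mx_rowE (R : realType) n (N : 'M[R[i]]_n) (r : 'rV[R[i]]_n)
    (t : R[i]) p :
  r *m N = t *: r -> r *m poly_mx N p = p.[t] *: r.
Proof.
move=> rN; rewrite horner_coef scaler_suml mulmx_sumr; apply: eq_bigr => i _.
by rewrite -scalemxAr (expmx_rowE _ rN) scalerA.
Qed.

Lemma poly_mx_colE (R : realType) n (N : 'M[R[i]]_n) (x : 'cV[R[i]]_n)
    (t : R[i]) p :
  N *m x = t *: x -> poly_mx N p *m x = p.[t] *: x.
Proof.
move=> Nx; rewrite horner_coef scaler_suml mulmx_suml; apply: eq_bigr => i _.
by rewrite -scalemxAl (expmx_colE _ Nx) scalerA.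
Qed.

Lemma shift_poly_mx_unit (R : realType) n (N : 'M[R[i]]_n)
    (sigma : seq (option R[i])) :
  shifts_not_eigenvalues N sigma -> poly_mx N (shift_poly sigma) \in unitmx.
Proof.
elim: sigma => [|a sigma IH] hN.
  by rewrite /shift_poly big_nil poly_mx1 unitmx1.
have {}IH : poly_mx N (shift_poly sigma) \in unitmx.
  by apply: IH => b hb; apply: hN; rewrite inE hb orbT.
case: a hN => [a|] hN //.
rewrite /shift_poly /= big_cons poly_mxM unitmx_mul -/(shift_poly sigma) IH
  andbT.
have := hN a (mem_head _ _).
by rewrite poly_mx_XsubC negbK kermx_eq0 row_free_unit.
Qed.

Lemma size_shift_poly (R : realType) (sigma : seq (option R[i])) :
  (size (shift_poly sigma) <= (size sigma).+1)%N.
Proof. by rewrite /shift_poly size_prod_XsubC size_pmap ltnS count_size. Qed.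

Lemma poly_mx_transfer (R : realType) m n s (A : 'M[R[i]]_n) (N : 'M[R[i]]_m)
    (G : 'M[R[i]]_(m, n)) (Y : 'M[R[i]]_(n, s)) (c : 'M[R[i]]_(m, s)) j
    (p : {poly R[i]}) :
  (forall k, (k <= j)%N -> G *m (A ^+ k *m Y) = N ^+ k *m c) ->
  (size p <= j.+1)%N -> G *m (poly_mx A p *m Y) = poly_mx N p *m c.
Proof.
move=> GA sp; rewrite !(poly_mx_widen _ sp) !mulmx_suml mulmx_sumr.
apply: eq_bigr => k _; rewrite -!scalemxAl -scalemxAr GA //.
by rewrite -ltnS.
Qed.

(** * Matrix polynomials acting on a block vector *)

Lemma mp_size_leP (R : realType) s (P : 'M[{poly R[i]}]_s) d :
  reflect (forall a b, (size (P a b) <= d)%N) (mp_size P <= d)%N.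
Proof.
apply: (iffP (bigmax_leqP _ _ _)) => h a.
  by move=> b; move/bigmax_leqP: (h a isT); apply.
by move=> _; apply/bigmax_leqP => b _; apply: h.
Qed.

Lemma mp_coef_eq0 (R : realType) s (P : 'M[{poly R[i]}]_s) i :
  (mp_size P <= i)%N -> mp_coef P i = 0.
Proof.
move=> /mp_size_leP le_Pi; apply/matrixP => a b; rewrite !mxE /=.
by rewrite nth_default.
Qed.

Lemma mp_act_widen (R : realType) s m (P : 'M[{poly R[i]}]_s) (N : 'M[R[i]]_m)
    (W : 'M[R[i]]_(m, s)) d :
  (mp_size P <= d)%N -> mp_act P N W = \sum_(i < d) N ^+ i *m W *m mp_coef P i.
Proof.
move=> le_pd; rewrite /mp_act.
rewrite (big_ord_widen _ (fun i => N ^+ i *m W *m mp_coef P i) le_pd).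
rewrite big_mkcond; apply: eq_bigr => i _.
by case: ltnP => // le_pi; rewrite mp_coef_eq0 // mulmx0.
Qed.

Lemma mp_eval_widen (R : realType) s (P : 'M[{poly R[i]}]_s) t d :
  (mp_size P <= d)%N -> mp_eval P t = \sum_(i < d) t ^+ i *: mp_coef P i.
Proof.
move=> /mp_size_leP le_pd; apply/matrixP => a b; rewrite !mxE summxE.
rewrite /horner_eval (horner_coef_wide _ (le_pd a b)).
by apply: eq_bigr => i _; rewrite !mxE mulrC.
Qed.

Lemma mp_actD (R : realType) s m (P Q : 'M[{poly R[i]}]_s) (N : 'M[R[i]]_m)
    (W : 'M[R[i]]_(m, s)) :
  mp_act (P + Q) N W = mp_act P N W + mp_act Q N W.
Proof.
pose d := maxn (mp_size (P + Q)) (maxn (mp_size P) (mp_size Q)).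
rewrite !(@mp_act_widen _ _ _ _ _ _ d) ?leq_max ?leqnn ?orbT //.
rewrite -big_split; apply: eq_bigr => i _ /=; rewrite -mulmxDr; congr (_ *m _).
by apply/matrixP => a b; rewrite !mxE /= coefD.
Qed.

Lemma mp_actZ (R : realType) s m (t : R[i]) (P : 'M[{poly R[i]}]_s)
    (N : 'M[R[i]]_m)
    (W : 'M[R[i]]_(m, s)) :
  mp_act (t%:P *: P) N W = t *: mp_act P N W.
Proof.
pose d := maxn (mp_size (t%:P *: P)) (mp_size P).
rewrite !(@mp_act_widen _ _ _ _ _ _ d) ?leq_max ?leqnn ?orbT //.
rewrite scaler_sumr; apply: eq_bigr => i _ /=; rewrite scalemxAr;
  congr (_ *m _).
by apply/matrixP => a b; rewrite !mxE /= coefCM.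
Qed.

Lemma mp_actX (R : realType) s m (P : 'M[{poly R[i]}]_s) (N : 'M[R[i]]_m)
    (W : 'M[R[i]]_(m, s)) :
  mp_act ('X *: P) N W = N *m mp_act P N W.
Proof.
pose d := maxn (mp_size ('X *: P)) (mp_size P).
rewrite (@mp_act_widen _ _ _ _ _ _ d.+1) ?leqW ?leq_maxl //.
rewrite (@mp_act_widen _ _ _ P _ _ d) ?leq_maxr //.
rewrite big_ord_recl [X in _ *m X]( _ : _ = 0) ?mulmx0 ?add0r; last first.
  by apply/matrixP => a b; rewrite !mxE /= coefXM.
rewrite mulmx_sumr; apply: eq_bigr => i _;
  rewrite !mulmxA -[N *m N ^+ i]/(N * N ^+ i) -exprS.
by congr (_ *m _); apply/matrixP => a b; rewrite !mxE /= coefXM.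
Qed.

Lemma mp_actC (R : realType) s m (M : 'M[R[i]]_s) (N : 'M[R[i]]_m)
    (W : 'M[R[i]]_(m, s)) :
  mp_act (map_mx polyC M) N W = W *m M.
Proof.
rewrite (@mp_act_widen _ _ _ _ _ _ 1); last first.
  by apply/mp_size_leP => a b; rewrite mxE size_polyC leq_b1.
rewrite big_ord1 expr0 mul1mx; congr (_ *m _).
by apply/matrixP => a b; rewrite !mxE /= coefC eqxx.
Qed.

Lemma mp_act_monomial (R : realType) s m k (N : 'M[R[i]]_m)
    (W : 'M[R[i]]_(m, s)) :
  mp_act ('X^k *: 1%:M) N W = N ^+ k *m W.
Proof.
elim: k => [|k IHk].
  rewrite !expr0 scale1r mul1mx.
  have -> : 1%:M = map_mx polyC 1%:M :> 'M[{poly R[i]}]_s by rewrite map_mx1.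
  by rewrite mp_actC mulmx1.
by rewrite exprS -scalerA mp_actX IHk mulmxA [in RHS]exprS.
Qed.

Lemma mp_size_monomial (R : realType) s k :
  (mp_size ('X^k *: 1%:M : 'M[{poly R[i]}]_s) <= k.+1)%N.
Proof.
apply/mp_size_leP => a b; rewrite !mxE mulr_natr.
by case: eqP => _; rewrite ?mulr1n ?size_polyXn // mulr0n size_poly0.
Qed.

(** An intertwining relation that is known only on the powers below d extends by
    linearity to all matrix polynomials of degree below d; on a Krylov space
    such a relation holds only up to the dimension in blocks. *)
Lemma mp_act_transfer (R : realType) s m m' (M : 'M[R[i]]_(m', m))
    (P : 'M[{poly R[i]}]_s) (N : 'M[R[i]]_m) (c : 'M[R[i]]_(m, s))
    (N' : 'M[R[i]]_m')
    (c' : 'M[R[i]]_(m', s)) d :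
  (forall k, (k < d)%N -> M *m (N ^+ k *m c) = N' ^+ k *m c') ->
  (mp_size P <= d)%N -> M *m mp_act P N c = mp_act P N' c'.
Proof.
move=> hM le_Pd; rewrite !(mp_act_widen _ _ le_Pd) mulmx_sumr.
by apply: eq_bigr => i _; rewrite mulmxA hM.
Qed.

(** The functional r, if it behaves on N^k c like evaluation at t, evaluates all
    matrix polynomials of small degree. It applies to left eigenvectors, where d
    is arbitrary, and to functionals built by prescribing r N^k c for k < d. *)
Lemma mp_act_eval (R : realType) s m (r : 'rV[R[i]]_m)
    (P : 'M[{poly R[i]}]_s) (N : 'M[R[i]]_m) (c : 'M[R[i]]_(m, s)) (t : R[i])
    w d :
  (forall k, (k < d)%N -> r *m (N ^+ k *m c) = t ^+ k *: w) ->
  (mp_size P <= d)%N -> r *m mp_act P N c = w *m mp_eval P t.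
Proof.
move=> hr le_Pd; rewrite (mp_act_widen _ _ le_Pd) (mp_eval_widen _ le_Pd).
rewrite !mulmx_sumr.
by apply: eq_bigr => i _; rewrite mulmxA hr // -scalemxAl -scalemxAr.
Qed.

(** The entrywise quotient is the matrix polynomial (P(z) - P(t)) / (z - t). *)
Definition mp_quot (R : realType) s (P : 'M[{poly R[i]}]_s) (t : R[i])
    : 'M[{poly R[i]}]_s :=
  map_mx (fun p => p %/ ('X - t%:P)) P.

Lemma mp_quotE (R : realType) s (P : 'M[{poly R[i]}]_s) (t : R[i]) :
  P = map_mx polyC (mp_eval P t) + ('X - t%:P) *: mp_quot P t.
Proof.
apply/matrixP => a b; rewrite !mxE {1}(divp_eq (P a b) ('X - t%:P)) modp_XsubC.
by rewrite addrC mulrC.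
Qed.

Lemma mp_size_quot (R : realType) s (P : 'M[{poly R[i]}]_s) t d :
  (mp_size P <= d.+1)%N -> (mp_size (mp_quot P t) <= d)%N.
Proof.
move=> /mp_size_leP hP; apply/mp_size_leP => a b.
rewrite mxE size_divp ?polyXsubC_eq0 // size_XsubC /= subn1.
by have := hP a b; case: size.
Qed.

Lemma mp_eval_quot (R : realType) s (P : 'M[{poly R[i]}]_s) (t z : R[i]) :
  mp_eval P z = mp_eval P t + (z - t) *: mp_eval (mp_quot P t) z.
Proof.
apply/matrixP => a b; rewrite {1}(mp_quotE P t) !mxE /horner_eval.
by rewrite hornerD hornerM hornerXsubC hornerC.
Qed.

Lemma mp_deriv_quot (R : realType) s (P : 'M[{poly R[i]}]_s) (t : R[i]) :
  mp_eval (mp_deriv P) t = mp_eval (mp_quot P t) t.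
Proof.
apply/matrixP => a b; rewrite {1}(mp_quotE P t) !mxE /horner_eval.
rewrite derivD derivM derivC derivXsubC add0r mul1r hornerD hornerM.
by rewrite hornerXsubC subrr mul0r addr0.
Qed.

(** Block form of P(N) o W = W P(t) + (N - t) (Q(N) o W): where the left side
    vanishes and P(t) v = 0, x = (Q(N) o W) v satisfies N x = t x. *)
Lemma mp_act_quot (R : realType) s m (P : 'M[{poly R[i]}]_s) (t : R[i])
    (N : 'M[R[i]]_m) (W : 'M[R[i]]_(m, s)) :
  mp_act P N W = W *m mp_eval P t
    + (N *m mp_act (mp_quot P t) N W - t *: mp_act (mp_quot P t) N W).
Proof.
rewrite {1}(mp_quotE P t) mp_actD mp_actC scalerBl mp_actD mp_actX.
by rewrite -scaleNr -polyCN mp_actZ scaleNr.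
Qed.

(** * Frobenius and spectral norms *)

(** Lagrange's identity: the difference of the two sides is half the sum of the
    squares of a_i b_k - a_k b_i. *)
Lemma real_cauchy_schwarz (R : realType) (I : finType) (a b : I -> R) :
  (\sum_i a i * b i) ^+ 2 <= (\sum_i a i ^+ 2) * (\sum_i b i ^+ 2).
Proof.
have : 0 <= \sum_i \sum_k (a i * b k - a k * b i) ^+ 2.
  by apply: sumr_ge0 => i _; apply: sumr_ge0 => k _; apply: sqr_ge0.
have -> : \sum_i \sum_k (a i * b k - a k * b i) ^+ 2
  = ((\sum_i a i ^+ 2) * (\sum_i b i ^+ 2) - (\sum_i a i * b i) ^+ 2) *+ 2.
  have e1 : (\sum_i a i ^+ 2) * (\sum_i b i ^+ 2)
      = \sum_i \sum_k a i ^+ 2 * b k ^+ 2.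
    by rewrite mulr_suml; apply: eq_bigr => i _; rewrite mulr_sumr.
  have e2 : (\sum_i a i * b i) ^+ 2 = \sum_i \sum_k (a i * b i) * (a k * b k).
    by rewrite expr2 mulr_suml; apply: eq_bigr => i _; rewrite mulr_sumr.
  have e1' : (\sum_i a i ^+ 2) * (\sum_i b i ^+ 2)
      = \sum_i \sum_k a k ^+ 2 * b i ^+ 2.
    rewrite mulrC mulr_suml; apply: eq_bigr => i _; rewrite mulr_sumr.
    by apply: eq_bigr => k _; rewrite mulrC.
  rewrite mulr2n {1}e1 e1' e2 -!sumrB -big_split; apply: eq_bigr => i _ /=.
  rewrite -!sumrB -big_split; apply: eq_bigr => k _ /=.
  by ring.
by rewrite pmulrn_lge0 // subr_ge0.
Qed.

Lemma normc_ge0 (R : realType) (z : R[i]) : 0 <= Normc.normc z.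
Proof. by case: z => x y; apply: sqrtr_ge0. Qed.

Lemma normF_ge0 (R : realType) m n (M : 'M[R[i]]_(m, n)) : 0 <= normF M.
Proof. exact: sqrtr_ge0. Qed.

Lemma normF_sqr (R : realType) m n (M : 'M[R[i]]_(m, n)) :
  normF M ^+ 2 = \sum_i \sum_j Normc.normc (M i j) ^+ 2.
Proof.
by rewrite sqr_sqrtr // sumr_ge0 // => i _; rewrite sumr_ge0 // => j _;
  apply: sqr_ge0.
Qed.

Lemma normF_eq0 (R : realType) m n (M : 'M[R[i]]_(m, n)) :
  normF M = 0 -> M = 0.
Proof.
move=> M0; have /eqP := normF_sqr M; rewrite M0 expr0n eq_sym psumr_eq0;
  last first.
  by move=> i _; rewrite sumr_ge0 // => j _; apply: sqr_ge0.
move=> /allP h; apply/matrixP => i j; rewrite mxE.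
have := h i; rewrite mem_index_enum => /(_ isT) /=.
rewrite psumr_eq0; last by move=> k _; apply: sqr_ge0.
move=> /allP /(_ j); rewrite mem_index_enum => /(_ isT) /=.
by rewrite sqrf_eq0 => /eqP /Normc.eq0_normc.
Qed.

Lemma normF0 (R : realType) m n : normF (0 : 'M[R[i]]_(m, n)) = 0.
Proof.
apply/eqP; rewrite -sqrf_eq0 normF_sqr big1 // => i _; rewrite big1 // => j _.
by rewrite mxE Normc.normc0 expr0n.
Qed.

Lemma normFZ (R : realType) m n (a : R[i]) (M : 'M[R[i]]_(m, n)) :
  normF (a *: M) = Normc.normc a * normF M.
Proof.
apply/eqP; rewrite -(@eqrXn2 _ 2) ?mulr_ge0 ?normF_ge0 ?normc_ge0 //.
rewrite exprMn !normF_sqr mulr_sumr; apply/eqP; apply: eq_bigr => i _.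
by rewrite mulr_sumr; apply: eq_bigr => j _; rewrite mxE Normc.normcM exprMn.
Qed.

Lemma normF_sqr_row (R : realType) m n (M : 'M[R[i]]_(m, n)) :
  normF M ^+ 2 = \sum_i normF (row i M) ^+ 2.
Proof.
rewrite normF_sqr; apply: eq_bigr => i _; rewrite normF_sqr big_ord1.
by apply: eq_bigr => j _; rewrite mxE.
Qed.

Lemma normF_sqr_col (R : realType) m n (M : 'M[R[i]]_(m, n)) :
  normF M ^+ 2 = \sum_j normF (col j M) ^+ 2.
Proof.
rewrite normF_sqr exchange_big; apply: eq_bigr => j _; rewrite normF_sqr.
by apply: eq_bigr => i _; rewrite big_ord1 mxE.
Qed.

Lemma normc_sum_le (R : realType) (I : finType) (F : I -> R[i]) :
  Normc.normc (\sum_i F i) <= \sum_i Normc.normc (F i).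
Proof.
elim/big_ind2: _ => [|x y z t h1 h2|//]; first by rewrite Normc.normc0.
exact: le_trans (le_normcD _ _) (lerD h1 h2).
Qed.

Lemma normc_dot_le (R : realType) n (r : 'rV[R[i]]_n) (x : 'cV[R[i]]_n) :
  Normc.normc ((r *m x) 0 0) <= normF r * normF x.
Proof.
rewrite -(@ler_pXn2r _ 2) ?nnegrE ?mulr_ge0 ?normF_ge0 ?normc_ge0 //.
have h : Normc.normc ((r *m x) 0 0)
    <= \sum_i Normc.normc (r 0 i) * Normc.normc (x i 0).
  rewrite mxE; apply: le_trans (normc_sum_le _) _.
  by apply: ler_sum => i _; rewrite Normc.normcM.
apply: (@le_trans _ _
  ((\sum_i Normc.normc (r 0 i) * Normc.normc (x i 0)) ^+ 2)).
  by rewrite lerXn2r ?nnegrE ?normc_ge0 // sumr_ge0 // => i _;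
    rewrite mulr_ge0 ?normc_ge0.
rewrite exprMn !normF_sqr big_ord1.
under [X in _ <= _ * X]eq_bigr do rewrite big_ord1.
exact: real_cauchy_schwarz.
Qed.

(** This crude bound serves to show that the supremum defining [norm2] is taken
    over a bounded set. *)
Lemma normF_mulmx_le (R : realType) m n (M : 'M[R[i]]_(m, n)) (x : 'cV[R[i]]_n)
    :
  normF (M *m x) <= normF M * normF x.
Proof.
rewrite -(@ler_pXn2r _ 2) ?nnegrE ?mulr_ge0 ?normF_ge0 //.
rewrite exprMn normF_sqr_row [normF M ^+ 2]normF_sqr_row mulr_suml.
apply: ler_sum => i _; rewrite normF_sqr 2!big_ord1 row_mul -exprMn.
by rewrite lerXn2r ?nnegrE ?mulr_ge0 ?normF_ge0 ?normc_ge0 ?normc_dot_le.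
Qed.

(** Rescaling x to a unit vector; [ub_le_sup] needs the bound of
    [normF_mulmx_le]. *)
Lemma normF_mulmx_col_le (R : realType) m n (M : 'M[R[i]]_(m, n))
    (x : 'cV[R[i]]_n) :
  normF (M *m x) <= norm2 M * normF x.
Proof.
have [x0|x_neq0] := eqVneq (normF x) 0.
  by rewrite (normF_eq0 x0) mulmx0 !normF0 mulr0.
have x_gt0 : 0 < normF x by rewrite lt_neqAle eq_sym x_neq0 normF_ge0.
pose a : R[i] := ((normF x)^-1)%:C.
have na : Normc.normc a = (normF x)^-1.
  by rewrite /a /= expr0n addr0 sqrtr_sqr ger0_norm // invr_ge0 normF_ge0.
rewrite -ler_pdivrMr // mulrC -na -normFZ scalemxAr.
apply: ub_le_sup; last first.
  by exists (a *: x) => //=; rewrite normFZ na mulVf.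
exists (normF M) => _ [y /= y1 <-].
by apply: le_trans (normF_mulmx_le _ _) _; rewrite y1 mulr1.
Qed.

(** In positive dimension the supremum is over a nonempty set of norms; in
    dimension 0 there is no unit vector and the supremum is 0. *)
Lemma norm2_ge0 (R : realType) m n (M : 'M[R[i]]_(m, n)) : 0 <= norm2 M.
Proof.
have [[x x1]|no_unit] := pselect (exists x : 'cV[R[i]]_n, normF x = 1).
  by rewrite -(mulr1 (norm2 M)) -x1; apply: le_trans (normF_mulmx_col_le M x);
    apply: normF_ge0.
rewrite /norm2 (_ : [set _ | x in _]%classic = set0) ?sup0 //.
by apply/seteqP; split => // _ [x /= x1 _]; case: no_unit; exists x.
Qed.

Lemma normF_mulmx_norm2_le (R : realType) m n p (M : 'M[R[i]]_(m, n))
    (V : 'M[R[i]]_(n, p)) :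
  normF (M *m V) <= norm2 M * normF V.
Proof.
rewrite -(@ler_pXn2r _ 2) ?nnegrE ?mulr_ge0 ?normF_ge0 ?norm2_ge0 //.
rewrite exprMn normF_sqr_col [normF V ^+ 2]normF_sqr_col mulr_sumr.
apply: ler_sum => k _; rewrite colE -mulmxA -colE -exprMn.
by rewrite lerXn2r ?nnegrE ?mulr_ge0 ?normF_ge0 ?norm2_ge0 ?normF_mulmx_col_le.
Qed.

Lemma normF_adj (R : realType) m n (M : 'M[R[i]]_(m, n)) :
  normF (M^t*) = normF M.
Proof.
apply/eqP; rewrite -(@eqrXn2 _ 2) ?normF_ge0 // !normF_sqr exchange_big;
  apply/eqP.
apply: eq_bigr => i _; apply: eq_bigr => j _; rewrite !mxE; congr (_ ^+ 2).
by case: (M i j) => a b; rewrite /= sqrrN.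
Qed.

(** Duality: [norm2] is defined by columns, so r L is paired with y = (r L)^H.
    Then |r L|^2 = r (L y) is at most |r| |L|_2 |r L|. *)
Lemma normF_mulmx_row_le (R : realType) m n (L : 'M[R[i]]_(m, n))
    (r : 'rV[R[i]]_m) :
  normF (r *m L) <= normF r * norm2 L.
Proof.
have [x0|x_neq0] := eqVneq (normF (r *m L)) 0.
  by rewrite x0 mulr_ge0 ?normF_ge0 ?norm2_ge0.
have x_gt0 : 0 < normF (r *m L) by rewrite lt_neqAle eq_sym x_neq0 normF_ge0.
rewrite -(ler_pM2r x_gt0) -expr2.
pose y := (r *m L)^t*.
have -> : normF (r *m L) ^+ 2 = Normc.normc ((r *m (L *m y)) 0 0).
  (* The product is r L (r L)^H, a nonnegative real number. *)
  have -> : (r *m (L *m y)) 0 0 = ((normF (r *m L)) ^+ 2)%:C.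
    rewrite normF_sqr big_ord1 mulmxA rmorph_sum mxE; apply: eq_bigr => j _.
    rewrite !mxE; case: (\sum_ _ _) => a b;
      rewrite /= sqr_sqrtr ?addr_ge0 ?sqr_ge0 //.
    by apply/eqP; rewrite eq_complex /=; apply/andP; split; apply/eqP; ring.
  by rewrite /= expr0n addr0 sqrtr_sqr ger0_norm // sqr_ge0.
apply: le_trans (normc_dot_le _ _) _; rewrite -mulrA ler_wpM2l ?normF_ge0 //.
by apply: le_trans (normF_mulmx_col_le _ _) _; rewrite normF_adj.
Qed.

(** The Frobenius norm is computed row by row, so that each row may carry a
    factor L of its own. *)
Lemma normF_rowwise_le (R : realType) m n (V M : 'M[R[i]]_(m, n))
    (L : 'I_m -> 'M[R[i]]_n) (c : R) :
  0 <= c -> (forall h, row h M = row h V *m L h) ->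
  (forall h, norm2 (L h) <= c) -> normF M <= normF V * c.
Proof.
move=> c_ge0 rowM le_c.
rewrite -(@ler_pXn2r _ 2) ?nnegrE ?mulr_ge0 ?normF_ge0 //.
rewrite exprMn normF_sqr_row [normF V ^+ 2]normF_sqr_row mulr_suml.
apply: ler_sum => h _; rewrite -exprMn rowM.
rewrite lerXn2r ?nnegrE ?mulr_ge0 ?normF_ge0 //.
apply: le_trans (normF_mulmx_row_le _ _) _;
  exact: (ler_wpM2l (normF_ge0 _) (le_c h)).
Qed.

(** * Functions of a diagonalizable matrix *)

(** Newton's scheme: each new node a is corrected by a multiple of the product
    that vanishes at the earlier nodes. *)
Lemma poly_interpolation (R : realType) (f : R[i] -> R[i]) (l : seq R[i]) :
  exists p : {poly R[i]}, forall x, x \in l -> p.[x] = f x.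
Proof.
elim: l => [|a l [p IHp]]; first by exists 0.
have [al|aNl] := boolP (a \in l).
  by exists p => x; rewrite inE => /orP[/eqP ->|]; apply: IHp.
pose q := \prod_(b <- l) ('X - b%:P).
have qa : q.[a] != 0 by rewrite -rootE root_prod_XsubC.
exists (p + ((f a - p.[a]) / q.[a])%:P * q) => x.
rewrite inE hornerD hornerCM => /orP[/eqP ->|xl].
  by rewrite mulfVK // addrC subrK.
have /rootP -> : root q x by rewrite root_prod_XsubC.
by rewrite mulr0 addr0 IHp.
Qed.

(** An eigenvector basis with its dual basis of rows. The number k of vectors is
    kept apart from the order m, which it equals only propositionally when the
    eigenvectors come with an index set of their own. *)
Definition eigenbasis (R : realType) m k (N : 'M[R[i]]_m)
    (x : 'I_k -> 'cV[R[i]]_m) (z : 'I_k -> 'rV[R[i]]_m) (d : 'I_k -> R[i])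
    : Prop :=
  [/\ forall i, N *m x i = d i *: x i, \sum_i x i *m z i = 1%:M
    & forall i l, z i *m x l = (i == l)%:R%:M].

(** Multiply by the resolution of the identity. *)
Lemma eigenbasis_eq (R : realType) m k (N : 'M[R[i]]_m) x z (d : 'I_k -> R[i])
    (P Q : 'M[R[i]]_m) :
  eigenbasis N x z d -> (forall i, P *m x i = Q *m x i) -> P = Q.
Proof.
case=> _ xz _ PQ; rewrite -[P]mulmx1 -[Q]mulmx1 -xz !mulmx_sumr.
by apply: eq_bigr => i _; rewrite !mulmxA PQ.
Qed.

Lemma eigenbasis_neq0 (R : realType) m k (N : 'M[R[i]]_m) x z
    (d : 'I_k -> R[i]) i :
  eigenbasis N x z d -> x i != 0.
Proof.
case=> _ _ /(_ i i) zx; apply/eqP => x0; move: zx.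
rewrite x0 mulmx0 eqxx => /matrixP /(_ 0 0); rewrite !mxE => /eqP.
by rewrite eq_sym oner_eq0.
Qed.

Lemma eigenbasis_row (R : realType) m k (N : 'M[R[i]]_m) x z (d : 'I_k -> R[i])
    i :
  eigenbasis N x z d -> z i *m N = d i *: z i.
Proof.
case=> Nx xz zx; rewrite -[N in LHS]mulmx1 -xz !mulmx_sumr (bigD1 i) //=.
rewrite [N *m _]mulmxA Nx -scalemxAl -scalemxAr mulmxA zx eqxx mul1mx.
rewrite big1 ?addr0 // => l li.
rewrite [N *m _]mulmxA Nx -scalemxAl -scalemxAr mulmxA zx eq_sym (negbTE li).
by rewrite mulr0n raddf0 mul0mx scaler0.
Qed.

(** All Jordan blocks have size 1. For the bound on the rank, Y is the operator
    that divides the i-th coordinate by d_i - lam, with the convention 0^-1 = 0: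
    it undoes one factor N - lam, except on the kernel of N - lam when e = 0. *)
Lemma lt_index_eigenbasis (R : realType) m k (N : 'M[R[i]]_m) x z
    (d : 'I_k -> R[i]) lam e :
  eigenbasis N x z d ->
  lt_index N lam e = (e == 0%N) && [exists i, d i == lam].
Proof.
move=> Nxz; have [Nx _ zx] := Nxz.
have Mx i e' : (N - lam%:M) ^+ e' *m x i = (d i - lam) ^+ e' *: x i.
  by apply: expmx_colE; rewrite mulmxBl Nx mul_scalar_mx scalerBl.
apply/idP/idP => [|/andP[/eqP -> /existsP[i /eqP dlam]]]; last first.
  rewrite /lt_index expr0 mxrank1 ltn_neqAle rank_leq_row andbT.
  apply/negP => /(_ =P m); rewrite -/(row_free _) => /eqP.
  rewrite -/(row_free _) row_free_unit => uM.
  have /eqP := eigenbasis_neq0 i Nxz; apply.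
  by rewrite -(mulKmx uM (x i)) Mx dlam subrr expr1 scale0r mulmx0.
apply: contraTT => h; rewrite -leqNgt.
pose Y := \sum_i (d i - lam)^-1 *: (x i *m z i).
have Yx i : Y *m x i = (d i - lam)^-1 *: x i.
  rewrite mulmx_suml (bigD1 i) //= -scalemxAl -mulmxA zx eqxx mulmx1.
  rewrite big1 ?addr0 // => l li.
  by rewrite -scalemxAl -mulmxA zx (negbTE li) -scalemx1 scale0r mulmx0 scaler0.
suff -> : (N - lam%:M) ^+ e = Y *m (N - lam%:M) ^+ e.+1 by exact: mxrankM_maxr.
apply: (eigenbasis_eq Nxz) => i.
rewrite -mulmxA !Mx -scalemxAr Yx scalerA; congr (_ *: _).
have [dlam|dNlam] := eqVneq (d i) lam; last first.
  by rewrite exprSr mulfK // subr_eq0.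
move: h; rewrite negb_and => /orP[|/existsPn/(_ i)]; last first.
  by rewrite dlam eqxx.
by rewrite dlam subrr exprS mul0r mul0r expr0n => /negbTE ->.
Qed.

(** By [lt_index_eigenbasis], Hermite interpolation on the spectrum demands no
    derivative, so that any interpolant of the values will do. *)
Lemma fun_mx_eigenbasis (R : realType) m k (f : R[i] -> R[i]) (N : 'M[R[i]]_m)
    x z (d : 'I_k -> R[i]) :
  eigenbasis N x z d ->
  exists2 p : {poly R[i]}, fun_mx f N = poly_mx N p
    & forall i, p.[d i] = f (d i).
Proof.
move=> Nxz.
have spec p : interpolates_on_spectrum f N p <-> forall i, p.[d i] = f (d i).
  split=> [h i|h lam e].
    apply: (h (d i) 0%N); rewrite (lt_index_eigenbasis _ _ Nxz) /=.
    by apply/existsP; exists i.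
  by rewrite (lt_index_eigenbasis _ _ Nxz) =>
    /andP[/eqP -> /existsP[i /eqP <-]]; apply: h.
have [p hp] := poly_interpolation f (codom d).
have : exists M, [set M | exists2 p, interpolates_on_spectrum f N p
    & M = poly_mx N p]%classic M.
  by exists (poly_mx N p); exists p => //; apply/spec => i; apply: hp;
    apply: codom_f.
move=> /(xgetPex 0) [q /spec hq eqq].
by exists q.
Qed.

Lemma eigenbasis_diag (R : realType) n (A X : 'M[R[i]]_n)
    (lambda : 'rV[R[i]]_n) :
  X \in unitmx -> A *m X = X *m diag_mx lambda ->
  eigenbasis A (fun h => col h X) (fun h => row h (invmx X))
  (fun h => lambda 0 h).
Proof.
move=> uX AX; split=> [h||h l].
- rewrite [in LHS]colE mulmxA -colE AX; apply/matrixP => a b.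
  by rewrite mul_mx_diag !mxE mulrC.
- rewrite -(mulmxV uX); apply/matrixP => a b; rewrite summxE mxE.
  by apply: eq_bigr => c _; rewrite mxE big_ord1 !mxE.
- apply/matrixP => a b; rewrite !ord1 !mxE eqxx mulr1n.
  have /matrixP /(_ h l) := mulVmx uX; rewrite !mxE => <-.
  by apply: eq_bigr => c _; rewrite !mxE.
Qed.

(** * Eigenvectors from a block characteristic polynomial *)

(** For orders that are equal but not convertible, such as a sum over j blocks
    of s columns and the product j s. *)
Lemma mulmx1C_cast (R : realType) m k (P : 'M[R[i]]_(m, k))
    (Q : 'M[R[i]]_(k, m)) :
  m = k -> P *m Q = 1%:M -> Q *m P = 1%:M.
Proof. by move=> e; case: _ / e P Q => P Q; apply: mulmx1C. Qed.

(** The dual vector z_i is defined by its values theta_i^k w_i on the Krylov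
    basis N^k c, k < j, so it evaluates at theta_i every matrix polynomial of
    degree below j, in particular the quotients Q_l = (P - P(theta_l)) /
    (z - theta_l). Thus z_i x_l = w_i Q_l(theta_i) v_l, which is
    w_i P'(theta_i) v_i = 1 for l = i, and vanishes otherwise because w_i and
    v_l annihilate P(theta_i) and P(theta_l). Biorthogonality of j s = m pairs makes
    the x_i a basis. *)
Lemma block_charpoly_eigenbasis (R : realType) s j m (N : 'M[R[i]]_m)
    (c : 'M[R[i]]_(m, s)) (D : nat -> 'M[R[i]]_(s, m)) (P : 'M[{poly R[i]}]_s)
    (theta : 'I_(j * s) -> R[i]) (v : 'I_(j * s) -> 'cV[R[i]]_s)
    (w : 'I_(j * s) -> 'rV[R[i]]_s) :
  m = (j * s)%N ->
  \sum_(k < j) N ^+ k *m c *m D k = 1%:M ->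
  (mp_size P <= j.+1)%N -> mp_act P N c = 0 ->
  injective theta ->
  (forall i, mp_eval P (theta i) *m v i = 0) ->
  (forall i, w i *m mp_eval P (theta i) = 0) ->
  (forall i, w i *m mp_eval (mp_deriv P) (theta i) *m v i = 1%:M) ->
  let x i := mp_act (mp_quot P (theta i)) N c *m v i in
  (exists z, eigenbasis N x z theta) /\ c = \sum_i x i *m w i.
Proof.
move=> em cD sP Pc theta_inj Pv wP wPv x.
have sum_s : (\sum_(k < j) s = j * s)%N by rewrite sum_nat_const card_ord.
pose M := \mxrow_(k < j) (N ^+ k *m c); pose E := \mxcol_(k < j) D k.
have ME : M *m E = 1%:M by rewrite mul_mxrow_mxcol.
(* M is the square Krylov matrix; its right inverse is a left inverse. *)
have EM : E *m M = 1%:M by apply: mulmx1C_cast ME; rewrite em sum_s.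
pose z i := (\mxrow_(k < j) (theta i ^+ k *: w i)) *m E.
have zc i k : (k < j)%N -> z i *m (N ^+ k *m c) = theta i ^+ k *: w i.
  move=> lt_kj.
  have : z i *m M = \mxrow_(k < j) (theta i ^+ k *: w i).
    by rewrite -mulmxA EM mulmx1.
  by rewrite mul_mxrow => /eq_mxrowP /(_ (Ordinal lt_kj)).
have zx i l : z i *m x l = (i == l)%:R%:M.
  rewrite mulmxA (mp_act_eval (zc i) (mp_size_quot _ sP)).
  have [->|il] := eqVneq i l; first by rewrite -mp_deriv_quot wPv.
  have th_neq : theta i - theta l != 0.
    by rewrite subr_eq0; apply: contraNneq il => /theta_inj ->.
  apply: (scalerI th_neq); rewrite scalemxAl scalemxAr.
  have -> : (theta i - theta l) *: mp_eval (mp_quot P (theta l)) (theta i)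
      = mp_eval P (theta i) - mp_eval P (theta l).
    by rewrite (mp_eval_quot P (theta l) (theta i)) addrAC subrr add0r.
  by rewrite mulmxBr mulmxBl wP mul0mx -mulmxA Pv mulmx0 subrr mulr0n raddf0
    scaler0.
have Nx i : N *m x i = theta i *: x i.
  have : mp_act P N c *m v i = 0 by rewrite Pc mul0mx.
  rewrite (mp_act_quot P (theta i)) mulmxDl -mulmxA Pv mulmx0 add0r mulmxBl.
  by rewrite -mulmxA -scalemxAl => /eqP; rewrite subr_eq0 => /eqP.
have xz : \sum_i x i *m z i = 1%:M.
  pose Xm := \matrix_(a, i) x i a 0; pose Zm := \matrix_(i, a) z i 0 a.
  have ZX : Zm *m Xm = 1%:M.
    apply/matrixP => i l; have /matrixP /(_ 0 0) := zx i l.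
    rewrite !mxE eqxx mulr1n => <-.
    by apply: eq_bigr => a _; rewrite !mxE.
  have XZ : Xm *m Zm = 1%:M by apply: mulmx1C_cast ZX.
  rewrite -XZ; apply/matrixP => a b; rewrite summxE mxE; apply: eq_bigr => i _.
  by rewrite mxE big_ord1 !mxE.
split; first by exists z.
(* The value z_i c = w_i is prescribed only if j > 0. *)
case: (posnP j) => [j0|j_gt0].
  apply/matrixP => a; suff : (a < 0)%N by [].
  by rewrite -[X in (_ < X)%N](mul0n s) -j0 -em.
rewrite -[c in LHS]mul1mx -xz mulmx_suml; apply: eq_bigr => i _.
by have := zc i 0%N j_gt0; rewrite expr0 scale1r mul1mx -mulmxA => ->.
Qed.

(** * Projection on the block rational Krylov space *)

(** As long as A^k Y stays in the range of V, it is fixed by V G, and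
    G A^(k+1) Y = (G A V) (G A^k Y); this gains the step k = j. *)
Lemma galerkin_krylov (R : realType) m n s (A : 'M[R[i]]_n)
    (V : 'M[R[i]]_(n, m)) (G : 'M[R[i]]_(m, n)) (Y : 'M[R[i]]_(n, s)) j k :
  (forall k, (k < j)%N -> V *m (G *m (A ^+ k *m Y)) = A ^+ k *m Y) ->
  (k <= j)%N -> G *m (A ^+ k *m Y) = (G *m A *m V) ^+ k *m (G *m Y).
Proof.
move=> hV; elim: k => [|k IHk] lt_kj; first by rewrite !expr0 !mul1mx.
rewrite [_ ^+ k.+1 in RHS]exprS -[RHS]mulmxA.
rewrite exprS -[A * _ *m Y]mulmxA -(hV k lt_kj) IHk; last exact: ltnW.
by rewrite !mulmxA.
Qed.

(** Powers of A commute with phi(A)^-1, so that the rational Krylov space of B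
    is the polynomial Krylov space of phi(A)^-1 B. *)
Lemma rk_elt_mp_act (R : realType) n s (A : 'M[R[i]]_n) (B : 'M[R[i]]_(n, s))
    sigma P :
  shifts_not_eigenvalues A sigma ->
  rk_elt A B sigma P = mp_act P A (invmx (poly_mx A (shift_poly sigma)) *m B).
Proof.
move=> /shift_poly_mx_unit uphi.
apply: mp_act_transfer (leqnn _) => k _; apply: (can_inj (mulKmx uphi)).
by rewrite mulKVmx // mulmxA -poly_mx_commX -mulmxA mulKVmx.
Qed.

Lemma block_spanP (R : realType) n s (U : nat -> 'M[R[i]]_(n, s)) m X :
  block_span U m X -> exists a, X = blocks U m *m a.
Proof.
case=> D ->; exists (\mxcol_(i < m) D i).
by rewrite mul_mxrow_mxcol.
Qed.

Lemma block_spanU (R : realType) n s (U : nat -> 'M[R[i]]_(n, s)) m (i : 'I_m) :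
  block_span U m (U i).
Proof.
exists (fun k => (k == i :> nat)%:R%:M); rewrite (bigD1 i) //= eqxx mulmx1.
rewrite big1 ?addr0 // => k ki.
by rewrite -val_eqE /= in ki; rewrite (negbTE ki) mulr0n raddf0 mulmx0.
Qed.

(** The projection is exact on the Krylov space. The last clause states that the
    blocks N^k c, k < j, span: each U_i lies in the Krylov space, hence
    U_i = P_i(A) o Y = V (P_i(N) o c), and G V = 1 expresses the identity by the
    coefficients of the P_i. *)
Lemma rk_coordinates (R : realType) n s j (U : nat -> 'M[R[i]]_(n, s))
    (A : 'M[R[i]]_n) (B : 'M[R[i]]_(n, s)) sigma (V := blocks U j)
    (G : 'M[R[i]]_(\sum_(i < j) s, n)) (N := G *m A *m V)
    (Y := invmx (poly_mx A (shift_poly sigma)) *m B) (c := G *m Y) :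
  shifts_not_eigenvalues A sigma -> block_rk A B sigma j = block_span U j ->
  G *m V = 1%:M ->
  [/\ forall k, (k <= j)%N -> G *m (A ^+ k *m Y) = N ^+ k *m c,
      forall k, (k < j)%N -> V *m (N ^+ k *m c) = A ^+ k *m Y
    & exists D : nat -> 'M[R[i]]_(s, _),
      \sum_(k < j) N ^+ k *m c *m D k = 1%:M].
Proof.
move=> hA hspan GV.
have inV k : (k < j)%N -> V *m (G *m (A ^+ k *m Y)) = A ^+ k *m Y.
  move=> lt_kj; have : block_rk A B sigma j (A ^+ k *m Y).
    exists ('X^k *: 1%:M); first exact: leq_trans (mp_size_monomial _ _ _)
      lt_kj.
    by rewrite rk_elt_mp_act // mp_act_monomial.
  rewrite hspan => /block_spanP[a ->].
  by rewrite [G *m _]mulmxA GV mul1mx.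
have GA k : (k <= j)%N -> G *m (A ^+ k *m Y) = N ^+ k *m c.
  by move=> le_kj; apply: galerkin_krylov inV le_kj.
have VN k : (k < j)%N -> V *m (N ^+ k *m c) = A ^+ k *m Y.
  by move=> lt_kj; rewrite -GA ?inV // ltnW.
split=> //.
have /fin_all_exists2[P sP UP] (i : 'I_j) :
    exists2 P, (mp_size P <= j)%N & U i = rk_elt A B sigma P.
  by have := block_spanU U i; rewrite -hspan.
exists (fun k => \mxrow_i mp_coef (P i) k).
transitivity (\mxrow_(i < j) \sum_(k < j) N ^+ k *m c *m mp_coef (P i) k).
  by rewrite mxrow_sum; apply: eq_bigr => k _; rewrite mul_mxrow.
rewrite -GV mul_mxrow; apply: eq_mxrow => i.
rewrite UP rk_elt_mp_act // -(mp_act_transfer VN (sP i)) mulmxA GV mul1mx.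
by rewrite (mp_act_widen _ _ (sP i)).
Qed.

(** The continuation block is Q(A) o Y with Q monic of degree j - 1, so
    Lambda - z Q has degree below j and contributes only to the span of the
    first j blocks. The last column of the Arnoldi relation handles A (Q(A) o Y); the
    vanishing last row of K removes U_j from its left side. *)
Lemma arnoldi_residual (R : realType) n s j (A : 'M[R[i]]_n)
    (B : 'M[R[i]]_(n, s))
    sigma (U : nat -> 'M[R[i]]_(n, s)) RB H K (Lambda : 'M[{poly R[i]}]_s) :
  (0 < j)%N ->
  shifts_not_eigenvalues A sigma ->
  block_rational_arnoldi A B j sigma U RB H K ->
  monic_continuation A B j sigma U RB K ->
  mp_size Lambda = j.+1 -> mp_monic Lambda ->
  exists a, rk_elt A B sigma Lambda = blocks U j *m a + U j *m H j j.-1 *m RB.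
Proof.
move=> j_gt0 hA arn [Q [sQ monQ rkQ]] sL monL.
(* Monicity of both polynomials cancels the coefficient of degree j. *)
have sLQ : (mp_size (Lambda + (-1)%:P *: ('X *: Q)) <= j)%N.
  apply/mp_size_leP => a b; apply/leq_sizeP => i.
  rewrite !mxE coefD coefCM mulN1r coefXM.
  have j1 : (j.-1.+1 = j)%N by rewrite prednK.
  rewrite leq_eqVlt => /orP[/eqP <-|lt_ji].
    rewrite -[j]j1 /= j1.
    have := congr1 (fun M : 'M[R[i]]_s => M a b) monL;
      rewrite /mp_lead sL /= !mxE /= => ->.
    have := congr1 (fun M : 'M[R[i]]_s => M a b) monQ;
      rewrite /mp_lead sQ /= !mxE /= => ->.
    by rewrite subrr.
  case: i lt_ji => // i lt_ji /=.
  have /mp_size_leP hL : (mp_size Lambda <= j.+1)%N by rewrite sL.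
  have /mp_size_leP hQ : (mp_size Q <= j)%N by rewrite sQ.
  by rewrite !nth_default ?subrr // ?(leq_trans (hL _ _)) ?(leq_trans (hQ _ _)).
have [a1 ea1] : exists a,
    rk_elt A B sigma (Lambda + (-1)%:P *: ('X *: Q)) = blocks U j *m a.
  apply: block_spanP; rewrite -(arnoldi_span arn).
  by exists (Lambda + (-1)%:P *: ('X *: Q)).
have lt_j1 : (j.-1 < j)%N by rewrite prednK.
pose jl : 'I_j := Ordinal lt_j1.
have AUK : A *m (\sum_(i < j) U i *m K i j.-1)
    = \sum_(i < j) U i *m H i j.-1 + U j *m H j j.-1.
  have := arnoldi_relation arn; rewrite -mulmxA !mul_mxrow_mxblock mul_mxrow.
  move=> /eq_mxrowP /(_ jl) /=; rewrite !big_ord_recr /=.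
  by rewrite (arnoldi_last_rowK arn lt_j1) mulmx0 addr0.
exists (a1 + (\mxcol_(i < j) H i j.-1) *m RB).
rewrite mulmxDr -ea1 -addrA mulmxA mul_mxrow_mxcol -mulmxDl -AUK -mulmxA rkQ.
by rewrite !rk_elt_mp_act // mp_actD mp_actZ mp_actX scaleN1r addrNK.
Qed.

(** * The error of the Petrov-Galerkin approximation *)

(** Both terms are expanded over the x_i: c = sum_i x_i w_i gives
    y = r Y = sum_i q_i with q_i = y Q_i(lam) v_i w_i, and r V x_i w_i = q_i. *)
Lemma galerkin_error_row (R : realType) m n s j k (A : 'M[R[i]]_n)
    (N fN : 'M[R[i]]_m)
    (V : 'M[R[i]]_(n, m)) (Y : 'M[R[i]]_(n, s)) (c : 'M[R[i]]_(m, s))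
    (P : 'M[{poly R[i]}]_s) (theta : 'I_k -> R[i]) (v : 'I_k -> 'cV[R[i]]_s)
    (w : 'I_k -> 'rV[R[i]]_s) (phi : {poly R[i]}) (f : R[i] -> R[i])
    (r : 'rV[R[i]]_n) (lam : R[i])
    (x := fun i => mp_act (mp_quot P (theta i)) N c *m v i) :
  (forall e, (e < j)%N -> V *m (N ^+ e *m c) = A ^+ e *m Y) ->
  (0 < j)%N -> (mp_size P <= j.+1)%N ->
  (forall i, mp_eval P (theta i) *m v i = 0) ->
  (forall i, N *m x i = theta i *: x i) ->
  (forall i, fN *m x i = f (theta i) *: x i) ->
  c = \sum_i x i *m w i ->
  r *m A = lam *: r ->
  f lam *: (r *m (poly_mx A phi *m Y))
    - r *m (V *m (fN *m (poly_mx N phi *m c)))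
  = r *m mp_act P A Y *m
    (\sum_i divdiff (fun t => phi.[t] * f t) lam (theta i) *: (v i *m w i)).
Proof.
move=> VN j_gt0 sP Pv Nx fx cE rA.
pose g t := phi.[t] * f t.
pose y := r *m Y.
have evalA Q : r *m mp_act Q A Y = y *m mp_eval Q lam.
  apply: mp_act_eval (leqnn _) => e _.
  by rewrite mulmxA (expmx_rowE _ rA) -scalemxAl.
pose q i := y *m mp_eval (mp_quot P (theta i)) lam *m v i *m w i.
have rVx i : r *m (V *m x i) *m w i = q i.
  rewrite /x [V *m _]mulmxA (mp_act_transfer VN (mp_size_quot _ sP)).
  by rewrite !mulmxA evalA.
have yE : y = \sum_i q i.
  have VcY : V *m c = Y by have := VN 0%N j_gt0; rewrite !expr0 !mul1mx.
  rewrite /y -VcY {1}cE !mulmx_sumr.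
  by apply: eq_bigr => i _; rewrite !mulmxA -rVx !mulmxA.
have -> : f lam *: (r *m (poly_mx A phi *m Y)) = g lam *: y.
  by rewrite mulmxA (poly_mx_rowE _ rA) -scalemxAl scalerA mulrC.
have -> : r *m (V *m (fN *m (poly_mx N phi *m c))) = \sum_i g (theta i) *: q i.
  rewrite cE !mulmx_sumr; apply: eq_bigr => i _.
  rewrite -rVx [poly_mx _ _ *m _]mulmxA (poly_mx_colE _ (Nx i)) -scalemxAl.
  rewrite -scalemxAr [fN *m _]mulmxA fx -scalemxAl scalerA -!scalemxAr.
  by rewrite !mulmxA.
rewrite yE scaler_sumr -sumrB evalA mulmx_sumr; apply: eq_bigr => i _.
rewrite -scalerBl -scalemxAr /divdiff -/(g lam) -/(g (theta i)) mulmxA.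
rewrite -[y *m _ *m v i]mulmxA (mp_eval_quot P (theta i)) mulmxDl Pv add0r.
rewrite -scalemxAl -scalemxAr mulmxA -/(q i).
(* When lam = theta_i both sides vanish: the left factor g(lam) - g(theta_i)
   is 0, and so is P(lam) v_i on the right. *)
have [->|lam_neq] := eqVneq lam (theta i).
  by rewrite !subrr !scale0r mul0mx scaler0.
by rewrite -scalemxAl scalerA divfK // subr_eq0.
Qed.

Theorem corollary3p3 (R : realType) (n s j : nat)
  (A : 'M[R[i]]_n) (B : 'M[R[i]]_(n, s)) (sigma : j.-1.-tuple (option R[i]))
  (hs : (1 < s)%N) (hj : (1 <= j)%N)
  (hsigmaA : shifts_not_eigenvalues A sigma)
  (U : nat -> 'M[R[i]]_(n, s)) (RB : 'M[R[i]]_s)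
  (H K : nat -> nat -> 'M[R[i]]_s)
  (harnoldi : block_rational_arnoldi A B j sigma U RB H K)
  (hmonic : monic_continuation A B j sigma U RB K)
  (Z : 'M[R[i]]_(n, \sum_(i < j) s))
  (hZ : Z^t* *m Z = 1%:M)
  (hZU : Z^t* *m blocks U j \in unitmx)
  (hsigmaAj : shifts_not_eigenvalues (pg_matrix A (blocks U j) Z) sigma)
  (Lambda : 'M[{poly R[i]}]_s)
  (hLambda : block_charpoly j (pg_matrix A (blocks U j) Z)
               (block_unit1 s j *m RB) Lambda)
  (hLambda_monic : mp_monic Lambda)
  (f : R[i] -> R[i])
  (hfA : forall z, eigenvalue A z -> analytic_at f z)
  (hfAj : fun_mx_defined f (pg_matrix A (blocks U j) Z))
  (theta : 'I_(j * s) -> R[i])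
  (htheta : char_poly (pg_matrix A (blocks U j) Z)
            = \prod_i ('X - (theta i)%:P))
  (htheta_simple : injective theta)
  (X : 'M[R[i]]_n) (lambda : 'rV[R[i]]_n)
  (hX : X \in unitmx) (hdiag : A *m X = X *m diag_mx lambda)
  (v w : 'I_(j * s) -> 'cV[R[i]]_s)
  (hv : forall i, right_eigenvector Lambda (theta i) (v i))
  (hw : forall i, left_eigenvector Lambda (theta i) (w i))
  (hvw : forall i,
    (w i)^t* *m mp_eval (mp_deriv Lambda) (theta i) *m v i = 1%:M) :
  let Aj := pg_matrix A (blocks U j) Z in
  let Fj := blocks U j *m fun_mx f Aj *m block_unit1 s j *m RB in
  let phi := shift_poly sigma in
  let L (z : R[i]) : 'M[R[i]]_s :=
    \sum_i divdiff (fun x => phi.[x] * f x) z (theta i) *: (v i *m (w i)^t*) in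
  normF (fun_mx f A *m B - Fj)
  <= cond2 X
     * normF (pg_coprojector (blocks U j) Z *m U j *m H j j.-1 *m RB)
     * \big[Num.max/0]_(h < n) norm2 (L (lambda 0 h)).
Proof.
(* The let-bindings lie below the coercion of the boolean inequality, so they
   are named afresh instead of being introduced. *)
pose V := blocks U j.
pose Aj := pg_matrix A V Z.
pose Fj := V *m fun_mx f Aj *m block_unit1 s j *m RB.
pose phi := shift_poly sigma.
pose L (z : R[i]) : 'M[R[i]]_s :=
  \sum_i divdiff (fun x => phi.[x] * f x) z (theta i) *: (v i *m (w i)^t*).
change (normF (fun_mx f A *m B - Fj)
  <= cond2 X * normF (pg_coprojector V Z *m U j *m H j j.-1 *m RB)
     * \big[Num.max/0]_(h < n) norm2 (L (lambda 0 h))).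
pose G := invmx (Z^t* *m V) *m Z^t*.
pose Y := invmx (poly_mx A phi) *m B.
pose c := G *m Y.
have GV : G *m V = 1%:M by rewrite -mulmxA mulVmx.
have sL : (mp_size Lambda <= j.+1)%N by case: hLambda => ->.
have [GA VN [D cD]] := rk_coordinates hsigmaA (arnoldi_span harnoldi) GV.
rewrite -/V -/phi -/Y -/c in GA VN cD.
rewrite -/(pg_matrix A V Z) -/Aj in GA VN cD.
have uphi : poly_mx A phi \in unitmx by apply: shift_poly_mx_unit.
have phiY : poly_mx A phi *m Y = B by rewrite mulKVmx.
have BE : B = V *m (block_unit1 s j *m RB).
  rewrite (arnoldi_start harnoldi) mulmxA mul_mxrow_mxcol.
  case: (j) hj => // j' _; rewrite big_ord_recl /= mulmx1 big1 ?addr0 // => i _.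
  by rewrite mulr0n raddf0 mulmx0.
have phic : poly_mx Aj phi *m c = block_unit1 s j *m RB.
  rewrite -(poly_mx_transfer GA) ?phiY.
    by rewrite BE mulmxA GV mul1mx.
  by apply: leq_trans (size_shift_poly _) _; rewrite size_tuple prednK.
have Lc : mp_act Lambda Aj c = 0.
  have uphiN : poly_mx Aj phi \in unitmx by apply: shift_poly_mx_unit.
  apply: (can_inj (mulKmx uphiN)); rewrite mulmx0.
  case: hLambda => _ <-; apply: mp_act_transfer (leqnn _) => k _.
  by rewrite mulmxA -poly_mx_commX -mulmxA phic.
have em : (\sum_(i < j) s = j * s)%N by rewrite sum_nat_const card_ord.
have Lv i : mp_eval Lambda (theta i) *m v i = 0 by case: (hv i).
have wL i : (w i)^t* *m mp_eval Lambda (theta i) = 0 by case: (hw i).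
have [[z xz] cE] :=
  block_charpoly_eigenbasis em cD sL Lc htheta_simple Lv wL hvw.
set x := (fun i => _ *m v i) in xz cE.
have [Nx _ _] := xz.
have fx i : fun_mx f Aj *m x i = f (theta i) *: x i.
  have [p -> <-] := fun_mx_eigenbasis f xz.
  exact: poly_mx_colE.
have AX := eigenbasis_diag hX hdiag.
have [p fA pf] := fun_mx_eigenbasis f AX.
have [a ea] := arnoldi_residual hj hsigmaA harnoldi hmonic
  (proj1 hLambda) hLambda_monic.
(* The residual has no component along V, because G sends it to
   Lambda(N) o c = 0. *)
have resE : pg_coprojector V Z *m U j *m H j j.-1 *m RB = mp_act Lambda A Y.
  have PiE : pg_coprojector V Z = 1%:M - V *m G by rewrite /pg_coprojector
    -mulmxA.
  have -> : pg_coprojector V Z *m U j *m H j j.-1 *m RB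
      = pg_coprojector V Z *m mp_act Lambda A Y.
    have PiV : pg_coprojector V Z *m V = 0.
      by rewrite PiE mulmxBl mul1mx -mulmxA GV mulmx1 subrr.
    by rewrite -rk_elt_mp_act // ea mulmxDr !mulmxA PiV mul0mx add0r.
  rewrite PiE mulmxBl mul1mx -mulmxA.
  rewrite (mp_act_transfer (d := j.+1) (N' := Aj) (c' := c)) // Lc.
  by rewrite mulmx0 subr0.
rewrite resE.
set E := _ - Fj.
(* The row h of X^-1 is a left eigenvector of A. *)
have rowE h : row h (invmx X *m E)
    = row h (invmx X *m mp_act Lambda A Y) *m L (lambda 0 h).
  have rA := eigenbasis_row h AX.
  rewrite !row_mul -(galerkin_error_row phi VN hj sL Lv Nx fx cE rA).
  rewrite phiY phic mulmxBr fA [_ *m (_ *m B)]mulmxA (poly_mx_rowE p rA) pf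
    -scalemxAl.
  by rewrite /Fj !mulmxA.
rewrite -(mulKVmx hX E).
apply: le_trans (normF_mulmx_norm2_le _ _) _.
rewrite /cond2 -!mulrA ler_wpM2l ?norm2_ge0 // mulrA.
have max_ge0 : 0 <= \big[Num.max/0]_(h < n) norm2 (L (lambda 0 h)).
  by elim/big_ind: _ => [//|y y' hy hy'|h _]; rewrite ?le_max ?hy ?norm2_ge0.
apply: le_trans (normF_rowwise_le max_ge0 rowE _) _.
  by move=> h; apply: le_bigmax.
by rewrite ler_wpM2r // normF_mulmx_norm2_le.
Qed.
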